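(* Let $a,k\geq 2$ be integers, let $n\geq 1$ be an integer, and let $G_k(x)=1+\sum_{m\geq 1}\frac{x^m}{m}\binom{km}{m-1}$. Then $$[x^n]\log^a G_k(x)=\sum_{p=a}^{n} c^{(p)}_{k,n}\,N_{p,a},$$ where $$c^{(p)}_{k,n}=\frac{kp-p}{kn-p}\binom{kn-p}{n-p}\qquad\text{and}\qquad N_{p,a}=\sum_{\substack{(q_1,\ldots,q_a)\in [p]^a\\ q_1+\cdots+q_a=p}}\frac{1}{\prod_{i=1}^{a} q_i}.$$
   Context: Here $[p]=\{1,\dots,p\}$, $[x^n]F(x)$ denotes the coefficient of $x^n$ in the formal power series $F$, $\log^a G_k=(\log G_k)^a$ is the $a$-th power of the formal logarithm of $G_k$ (a formal power series with constant term $1$), and an empty sum (when $n<a$) is $0$. *)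

(* Defs.v *)
From mathcomp Require Import all_boot all_order all_algebra.

Set Implicit Arguments.
Unset Strict Implicit.
Unset Printing Implicit Defensive.

Import GRing.Theory Num.Theory.
Local Open Scope ring_scope.

(* A formal power series over rat is its sequence of coefficients:
   [F n] stands for [x^n] F(x). *)
Definition fps := nat -> rat.

Definition fps_one : fps := fun n => (n == 0)%N%:R.

Definition fps_sub (F G : fps) : fps := fun n => F n - G n.

Definition fps_mul (F G : fps) : fps :=
  fun n => \sum_(i < n.+1) F i * G (n - i)%N.

Definition fps_exp (F : fps) (j : nat) : fps := iter j (fps_mul F) fps_one.

(* Justifies the finite range of summation in [fps_log]. *)
Lemma fps_exp_coef0 (F : fps) (j n : nat) :
  F 0%N = 0 -> (n < j)%N -> fps_exp F j n = 0.
Proof.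
move=> F0; elim: j n => [//|j IHj] n lt_nj.
rewrite /fps_exp iterS /fps_mul big1 // => -[[|i] lt_in] _ /=.
  by rewrite F0 mul0r.
rewrite [iter _ _ _ _]IHj ?mulr0 // ltn_subLR // addSn.
by apply: leq_trans lt_nj _; rewrite ltnS leq_addl.
Qed.

(* log F = \sum_(j >= 1) (-1)^(j-1) / j * (F - 1)^j, meaningful when F has
   constant term 1; then (F - 1)^j has no coefficient below x^j, so that only
   the terms with j <= n contribute to the coefficient of x^n. *)
Definition fps_log (F : fps) : fps := fun n =>
  \sum_(1 <= j < n.+1)
     (-1) ^+ (j - 1)%N / j%:R * fps_exp (fps_sub F fps_one) j n.

Definition Gk (k : nat) : fps := fun m =>
  if (m == 0)%N then 1 else m%:R^-1 * 'C(k * m, m - 1)%N%:R.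

(* Used for a <= p <= n with k >= 2 and n >= 1: the natural number
   subtractions are then exact and k * n - p is positive. *)
Definition coef_c (k n p : nat) : rat :=
  (k * p - p)%N%:R / (k * n - p)%N%:R * 'C(k * n - p, n - p)%N%:R.

(* ['I_p.+1] is {0, ..., p}; the condition 0 < q i restricts it to [p]. *)
Definition coef_N (p a : nat) : rat :=
  \sum_(q : {ffun 'I_a -> 'I_p.+1} |
          [forall i, (0 < q i)%N] && (\sum_(i < a) q i == p)%N)
     (\prod_(i < a) (q i)%:R)^-1.

(* Main.v *)
(* Write w = G_k - 1. Lagrange inversion suggests w = x G_k^k, so that
   G_k (1 - y) = 1 for y = x G_k^(k-1), whence log G_k = \sum_q y^q / q and
   log^a G_k = \sum_p N_(p,a) y^p; the coefficients of y^p are the c^(p)_(k,n).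
   Inversion is avoided by working with the closed form [raney k r n] of
   [x^n] G_k^r: its convolution rule follows from the recursion
   G_k^(r+1) = G_k^r + x G_k^(r+k). Both sides of log G_k = \sum_q y^q / q have
   n-th coefficient C(kn - 1, n - 1) / n, by an alternating binomial sum on the
   left and by the hockey-stick identity on the right. *)
Require Import Defs.
From mathcomp Require Import all_boot all_order all_algebra.
From mathcomp Require Import ring zify.

Set Implicit Arguments.
Unset Strict Implicit.
Unset Printing Implicit Defensive.

Import GRing.Theory Num.Theory.
Local Open Scope ring_scope.

Lemma eq_fps_mul (F F' G G' : fps) :
  F =1 F' -> G =1 G' -> fps_mul F G =1 fps_mul F' G'.
Proof. by move=> eF eG n; apply: eq_bigr => i _; rewrite eF eG. Qed.

Lemma eq_fps_exp (F F' : fps) (j : nat) :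
  F =1 F' -> fps_exp F j =1 fps_exp F' j.
Proof. by move=> eF; elim: j => // j IHj; apply: eq_fps_mul. Qed.

(** Truncation at degree N leaves the coefficients below N of a power intact, so powers of series
    can be expanded with the ring theory of [{poly rat}]. *)
Lemma coef_exp_poly (F : fps) (N j n : nat) :
  (n < N)%N -> ((\poly_(i < N) F i) ^+ j)`_n = fps_exp F j n.
Proof.
elim: j n => [|j IHj] n ltnN; first by rewrite expr0 coef1.
rewrite exprS coefM; apply: eq_bigr => i _.
have leiN : (i < N)%N by apply: leq_ltn_trans ltnN; rewrite -ltnS.
by rewrite coef_poly leiN IHj // (leq_ltn_trans (leq_subr _ _) ltnN).
Qed.

(** * Binomial identities *)

Lemma bin_succ_ratio (T m : nat) : (m <= T)%N ->
  'C(T, m.+1)%:R = (T%:R - m%:R) / m.+1%:R * 'C(T, m)%:R :> rat.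
Proof.
move=> le_mT; apply: (mulfI (x := m.+1%:R)); first by rewrite pnatr_eq0.
rewrite -natrM mul_bin_left natrM natrB //; field.
by rewrite nat1r pnatr_eq0.
Qed.

(** Pascal's rule makes the sum telescope; equivalently, (1 + x)^(T+1) / (1 + x) = (1 + x)^T. *)
Lemma sum_alternating_bin (T N : nat) :
  \sum_(j < N.+1) (-1) ^+ j * 'C(T.+1, N - j)%N%:R = 'C(T, N)%:R :> rat.
Proof.
elim: N => [|N IHN]; first by rewrite big_ord1 expr0 mul1r !bin0.
rewrite big_ord_recl expr0 mul1r subn0.
under eq_bigr => j _ do rewrite lift0 subSS exprS mulN1r mulNr.
by rewrite sumrN IHN binS natrD addrK.
Qed.

Lemma sum_bin_diag (D N : nat) :
  (\sum_(p < N.+1) 'C(D + (N - p), N - p) = 'C((D + N).+1, N))%N.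
Proof.
elim: N => [|N IHN]; first by rewrite big_ord1 !bin0.
rewrite big_ord_recl subn0.
under eq_bigr => j _ do rewrite lift0 subSS.
by rewrite IHN addnS binS.
Qed.

(** * Powers of G_k *)

(* [x^n] G_k^r = r / (kn + r) C(kn + r, n), in a form free of the division 0 / 0
   at n = r = 0. *)
Definition raney (k r : nat) : fps := fun n =>
  if n is m.+1 then r%:R / n%:R * 'C((k * n + r).-1, m)%:R else 1.

Lemma raney0 (k : nat) : raney k 0 =1 fps_one.
Proof. by case=> [|n]; rewrite //= mul0r mul0r. Qed.

Lemma raneyS (k r n : nat) : (0 < k)%N ->
  raney k r.+1 n.+1 = raney k r n.+1 + raney k (r + k)%N n.
Proof.
move=> k_gt0; case: n => [|m] /=; first by rewrite !bin0; field.
(* All three binomials get the top T or T + 1. Pascal's rule and [bin_succ_ratio] reduce them to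
   multiples of C(T, m), leaving a rational identity. *)
have -> : ((k * m.+2 + r.+1).-1 = (k * m.+2 + r).-1.+1)%N by nia.
have -> : ((k * m.+1 + (r + k)).-1 = (k * m.+2 + r).-1)%N by nia.
set T := (_ .-1); have ET : (T.+1 = k * m.+2 + r)%N by rewrite /T; nia.
have {}ET : T%:R = k%:R * (m%:R + 2) + r%:R - 1 :> rat.
  by rewrite -[2]/(2%:R) -natrD addn2 -natrM -natrD -ET -natr1 addrK.
rewrite binS natrD bin_succ_ratio; last by rewrite /T; nia.
rewrite ET -!(natr1 m.+1) -!(natr1 m) -(natr1 r) natrD; field.
by rewrite !natr1 !pnatr_eq0.
Qed.

(** Induction on n, then on r: [raneyS] leads either to a smaller r or to a smaller n with exponent
    r + k, hence the outer hypothesis for every r. *)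
Lemma raney_mul (k r s : nat) : (0 < k)%N ->
  fps_mul (raney k r) (raney k s) =1 raney k (r + s)%N.
Proof.
move=> k_gt0 n; elim: n r => [|n IHn] r.
  by rewrite /fps_mul big_ord1 mulr1.
elim: r => [|r IHr].
  rewrite /fps_mul big_ord_recl mul1r big1 ?addr0 // => i _.
  by rewrite raney0 mul0r.
rewrite addSn raneyS // -IHr addnAC -IHn /fps_mul.
rewrite big_ord_recl [X in _ = X + _]big_ord_recl -addrA -big_split /=.
congr (_ + _); apply: eq_bigr => i _.
by rewrite -mulrDl -raneyS.
Qed.

(* The coefficients of (x G_k^s)^p. *)
Definition raney_pow (k s p : nat) : fps := fun n =>
  if (p <= n)%N then raney k (s * p)%N (n - p)%N else 0.

Lemma raney_pow_mul (k s p q : nat) : (0 < k)%N ->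
  fps_mul (raney_pow k s p) (raney_pow k s q) =1 raney_pow k s (p + q)%N.
Proof.
move=> k_gt0 n; rewrite /fps_mul /raney_pow.
case: leqP => [le_pqn | lt_npq]; last first.
  rewrite big1 // => i _; have lt_in := ltn_ord i.
  case: leqP => [le_pi|]; last by rewrite mul0r.
  by rewrite leqNgt (_ : (_ < q)%N) ?mulr0 //; lia.
rewrite mulnDr -raney_mul // /fps_mul.
rewrite -(big_mkord xpredT (fun i =>
  (if (p <= i)%N then raney k (s * p)%N (i - p)%N else 0) *
  (if (q <= n - i)%N then raney k (s * q)%N (n - i - q)%N else 0))).
(* Only p <= i <= n - q contributes: both tails are cut off and the index is shifted by p. *)
rewrite (big_cat_nat (n := p)) //=; last by lia.
rewrite big1_seq ?add0r; last first.
  move=> i; rewrite mem_index_iota => /andP[_ /andP[_ ltip]].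
  by rewrite leqNgt ltip mul0r.
rewrite (big_cat_nat (n := (n - q).+1)) //=; try lia.
rewrite [X in _ + X]big1_seq ?addr0; last first.
  move=> i; rewrite mem_index_iota => /andP[_ /andP[lti ltin]].
  by rewrite [(q <= _)%N]leqNgt (_ : (_ < q)%N) ?mulr0 //; lia.
rewrite -{1}[p]add0n big_addn big_mkord.
have -> : ((n - q).+1 - p = (n - (p + q)).+1)%N by lia.
apply: eq_bigr => i _; rewrite leq_addl addnK.
have lt_i := ltn_ord i; rewrite ifT; last by lia.
by congr (_ * raney _ _ _); lia.
Qed.

Lemma raney_powX (k s j : nat) : (0 < k)%N ->
  fps_exp (raney_pow k s 1) j =1 raney_pow k s j.
Proof.
move=> k_gt0; elim: j => [|j IHj] n.
  by rewrite /raney_pow muln0 subn0 raney0.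
rewrite -[LHS]/(fps_mul (raney_pow k s 1) (fps_exp (raney_pow k s 1) j) n).
by rewrite (eq_fps_mul (fun=> erefl) IHj) raney_pow_mul // add1n.
Qed.

(** * The logarithm of G_k *)

Lemma Gk_sub1 (k : nat) : (0 < k)%N ->
  fps_sub (Gk k) fps_one =1 raney_pow k k 1.
Proof.
move=> k_gt0 [|n]; first by rewrite /fps_sub subrr.
rewrite /fps_sub /fps_one subr0 /raney_pow ltn0Sn subSS subn0 muln1.
(* The recursion at r = 0 reads G_k = 1 + x G_k^k. *)
have := raneyS 0 n k_gt0; rewrite raney0 [fps_one _]/= add0r add0n => <-.
by rewrite /Gk /= subSS subn0 addn1 mul1r.
Qed.

(** With N = n + 1, the N-th coefficient of (G_k - 1)^j = x^j G_k^(kj) is j/N C(kN, N - j); the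
    factor 1/j of the logarithm cancels this j and leaves an alternating sum. *)
Lemma log_Gk_coef (k n : nat) : (0 < k)%N ->
  fps_log (Gk k) n.+1 = 'C((k * n.+1).-1, n)%:R / n.+1%:R.
Proof.
move=> k_gt0; rewrite /fps_log -[1%N]add0n big_addn subn1 big_mkord.
have kn_gt0 : (0 < k * n.+1)%N by rewrite muln_gt0 k_gt0.
rewrite -sum_alternating_bin mulr_suml prednK //; apply: eq_bigr => j _.
rewrite addn1 subSS subn0 (eq_fps_exp _ (Gk_sub1 k_gt0)) raney_powX //.
have le_jn : (j <= n)%N := ltn_ord j; rewrite /raney_pow ltnS le_jn.
rewrite subSS -mulrA -[RHS]mulrA; congr (_ * _).
have j1 : j.+1%:R != 0 :> rat by rewrite pnatr_eq0.
have n1 : n.+1%:R != 0 :> rat by rewrite pnatr_eq0.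
case E: (n - j)%N => [|m].
  by rewrite mulr1 bin0 mul1r (_ : nat_of_ord j = n) //; lia.
rewrite /raney (_ : k * m.+1 + k * j.+1 = k * n.+1)%N; last by nia.
have m1 : m.+1%:R != 0 :> rat by rewrite pnatr_eq0.
have D : (k * n.+1)%:R * 'C((k * n.+1).-1, m)%:R
         = m.+1%:R * 'C(k * n.+1, m.+1)%:R :> rat.
  by rewrite -!natrM mul_bin_diag.
apply: (mulfI m1); rewrite mulrA [RHS]mulrA -D !natrM; field.
by rewrite ?nat1r j1 n1 m1.
Qed.

Lemma log_Gk_expansion (s n : nat) : (0 < s)%N ->
  fps_log (Gk s.+1) n =
  \sum_(p < n.+1) (p%:R)^-1 * raney_pow s.+1 s p n.
Proof.
move=> s_gt0; case: n => [|n].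
  by rewrite big_ord1 invr0 mul0r /fps_log big_geq.
(* The term p = 0 vanishes because 0^-1 = 0 in [rat]. *)
rewrite log_Gk_coef // big_ord_recl invr0 mul0r add0r.
have -> : ((s.+1 * n.+1).-1 = ((s * n.+1).-1 + n).+1)%N by nia.
rewrite -sum_bin_diag natr_sum mulr_suml; apply: eq_bigr => p _.
rewrite lift0; have le_pn : (p <= n)%N := ltn_ord p.
rewrite /raney_pow ltnS le_pn subSS.
have p1 : p.+1%:R != 0 :> rat by rewrite pnatr_eq0.
have n1 : n.+1%:R != 0 :> rat by rewrite pnatr_eq0.
case E: (n - p)%N => [|m].
  by rewrite mulr1 bin0 mul1r (_ : nat_of_ord p = n) //; lia.
have m1 : m.+1%:R != 0 :> rat by rewrite pnatr_eq0.
rewrite /raney.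
have -> : ((s.+1 * m.+1 + s * p.+1).-1 = (s * n.+1).-1 + m.+1)%N by nia.
rewrite bin_succ_ratio; last by lia.
have -> : ((s * n.+1).-1 + m.+1 = s * n.+1 + m)%N by nia.
by rewrite natrD addrK !natrM; field; rewrite ?nat1r p1 n1 m1.
Qed.

(** * Substitution of x G_k^s *)

(* F(x G_k^s). *)
Definition fps_comp_raney (k s : nat) (F : fps) : fps := fun n =>
  \sum_(p < n.+1) F p * raney_pow k s p n.

(** Gives the inner sums of a product a common range, so that summations can be exchanged. *)
Lemma fps_comp_raney_widen (k s : nat) (F : fps) (n N : nat) : (n <= N)%N ->
  fps_comp_raney k s F n = \sum_(p < N.+1) F p * raney_pow k s p n.
Proof.
move=> le_nN; rewrite /fps_comp_raney.
rewrite (big_ord_widen N.+1 (fun p => F p * raney_pow k s p n)) //.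
rewrite big_mkcond /=; apply: eq_bigr => p _.
by rewrite ltnS /raney_pow; case: leqP => //; rewrite mulr0.
Qed.

Lemma fps_comp_raney_mul (k s : nat) (F G : fps) : (0 < k)%N ->
  fps_mul (fps_comp_raney k s F) (fps_comp_raney k s G) =1
  fps_comp_raney k s (fps_mul F G).
Proof.
move=> k_gt0 n.
transitivity (\sum_(p < n.+1) \sum_(q < n.+1)
                F p * G q * raney_pow k s (p + q)%N n).
  rewrite /fps_mul; under eq_bigr => i _.
    rewrite (@fps_comp_raney_widen k s F i n); last by rewrite -ltnS.
    rewrite (@fps_comp_raney_widen k s G (n - i)%N n) ?leq_subr //.
    rewrite mulr_suml; under eq_bigr => p _ do rewrite mulr_sumr.
    over.
  rewrite exchange_big; apply: eq_bigr => p _ /=.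
  rewrite exchange_big; apply: eq_bigr => q _ /=.
  rewrite -raney_pow_mul // mulr_sumr; apply: eq_bigr => i _.
  by rewrite mulrACA.
rewrite /fps_comp_raney /fps_mul.
(* Reindexing by r = p + q; the terms with r > n vanish. *)
transitivity (\sum_(p < n.+1) \sum_(r < n.+1 | (p <= r)%N)
                F p * G (r - p)%N * raney_pow k s r n).
  apply: eq_bigr => p _; have le_pn : (p <= n)%N by rewrite -ltnS.
  rewrite -(big_mkord xpredT (fun q => F p * G q * raney_pow k s (p + q)%N n)).
  rewrite -(big_mkord (fun r => p <= r)%N
             (fun r => F p * G (r - p)%N * raney_pow k s r n)).
  rewrite (big_cat_nat (n := (n - p).+1)) //=; last by lia.
  rewrite [X in _ + X]big1_seq ?addr0; last first.
    move=> q; rewrite mem_index_iota => /andP[_ /andP[ltq _]].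
    by rewrite /raney_pow leqNgt (_ : (n < _)%N) ?mulr0 //; lia.
  rewrite [RHS](big_cat_nat (n := p)) //=; last by lia.
  rewrite [X in _ = X + _]big1_seq ?add0r => [|r]; last first.
    by rewrite mem_index_iota => /andP[le_pr /andP[_]]; rewrite ltnNge le_pr.
  rewrite -[X in _ = \sum_(X <= _ < _ | _) _]add0n big_addn subSn //.
  by apply: eq_big => [r | r _]; rewrite ?leq_addl // addnK addnC.
rewrite (exchange_big_dep xpredT) //=; apply: eq_bigr => r _.
rewrite mulr_suml (big_ord_widen n.+1 (fun p =>
  F p * G (r - p)%N * raney_pow k s r n)) //.
Qed.

Lemma fps_comp_raney_exp (k s : nat) (F : fps) (j : nat) : (0 < k)%N ->
  fps_exp (fps_comp_raney k s F) j =1 fps_comp_raney k s (fps_exp F j).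
Proof.
move=> k_gt0; elim: j => [|j IHj] n.
  rewrite /fps_comp_raney big_ord_recl big1 => [|i _]; last by rewrite mul0r.
  by rewrite addr0 mul1r /raney_pow muln0 subn0 raney0.
by rewrite -fps_comp_raney_mul //; apply: eq_fps_mul.
Qed.

(** * The numbers N and c as coefficients *)

Lemma coef_NE (p a : nat) : coef_N p a = fps_exp (fun q => q%:R^-1) a p.
Proof.
(* Truncating at degree p makes distributivity expand the power over exactly the functions from
   ['I_a] to ['I_p.+1] that index [coef_N]. *)
rewrite -(coef_exp_poly _ a (ltnSn p)) poly_def -[X in _ ^+ X]card_ord
  -prodr_const.
rewrite bigA_distr_bigA coef_sum /coef_N big_mkcond /=.
apply: eq_bigr => q _.
have -> : \prod_(i < a) ((q i)%:R^-1 *: 'X^(q i)) =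
          (\prod_(i < a) (q i)%:R)^-1 *: 'X^(\sum_(i < a) q i) :> {poly rat}.
  rewrite scaler_prod prodfV; congr (_ *: _).
  by rewrite -expr_sum.
rewrite coefZ coefXn eq_sym; case: eqP => _; last by rewrite andbF mulr0.
rewrite mulr1 andbT; case: ifPn => // /forallPn[i].
(* The coefficient 0^-1 = 0 takes care of the condition [0 < q i]. *)
rewrite lt0n negbK => /eqP qi0.
by rewrite (bigD1 i) //= qi0 mul0r invr0.
Qed.

(** With M = kn - p and k = s + 1, absorption M C(M - 1, n - p - 1) = (n - p) C(M, n - p) trades the
    denominator M for n - p; p = n is treated apart. *)
Lemma coef_cE (s n p : nat) : (0 < s)%N -> (0 < p <= n)%N ->
  coef_c s.+1 n p = raney_pow s.+1 s p n.
Proof.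
move=> s_gt0 /andP[p_gt0 le_pn]; rewrite /coef_c /raney_pow le_pn.
have -> : (s.+1 * p - p = s * p)%N by nia.
have S0 : (s.+1 * n - p)%:R != 0 :> rat by rewrite pnatr_eq0; nia.
case E: (n - p)%N => [|m].
  rewrite bin0 mulr1 (_ : s.+1 * n - p = s * p)%N ?divff //; last by nia.
  by rewrite pnatr_eq0; nia.
rewrite /raney (_ : s.+1 * m.+1 + s * p = s.+1 * n - p)%N; last by nia.
have m1 : m.+1%:R != 0 :> rat by rewrite pnatr_eq0.
have D : (s.+1 * n - p)%:R * 'C((s.+1 * n - p).-1, m)%:R
         = m.+1%:R * 'C(s.+1 * n - p, m.+1)%:R :> rat.
  by rewrite -!natrM mul_bin_diag.
rewrite mulrC mulrA; apply: (canLR (mulfK S0)).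
rewrite mulrC [RHS]mulrC mulrCA -[RHS]mulrA; congr (_ * _).
by rewrite D mulKf.
Qed.

Theorem theorem9 (a k n : nat) (ha : (2 <= a)%N) (hk : (2 <= k)%N)
    (hn : (1 <= n)%N) :
  fps_exp (fps_log (Gk k)) a n =
    \sum_(a <= p < n.+1) coef_c k n p * coef_N p a.
Proof.
case: k hk => // s s_gt0.
rewrite (eq_fps_exp _ (fun m => log_Gk_expansion m s_gt0)).
rewrite (@fps_comp_raney_exp _ _ (fun q => q%:R^-1)) // /fps_comp_raney.
under eq_bigr => p _ do rewrite -coef_NE.
(* The series with coefficients 1/q has constant term 0^-1 = 0, so its a-th power starts at x^a. *)
have N0 p : (p < a)%N -> coef_N p a = 0.
  by move=> lt_pa; rewrite coef_NE fps_exp_coef0 ?invr0.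
rewrite -(big_mkord xpredT (fun p => coef_N p a * raney_pow s.+1 s p n)).
have [le_an | lt_na] := leqP a n.+1; last first.
  rewrite [RHS]big_geq ?(ltnW lt_na) // big1_seq // => p.
  rewrite mem_index_iota => /andP[_ /andP[_ ltp]]; rewrite N0 ?mul0r //.
  exact: ltn_trans lt_na.
rewrite (big_cat_nat (n := a)) //= big1_seq ?add0r; last first.
  move=> p; rewrite mem_index_iota => /andP[_ /andP[_ ltp]].
  by rewrite N0 ?mul0r.
rewrite !big_nat; apply: eq_bigr => p /andP[le_ap le_pn].
by rewrite mulrC coef_cE // -[(p <= n)%N]ltnS le_pn andbT (leq_trans (ltnW ha)).
Qed.
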